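(* Let $K$ be a field, $d\in\mathbb{N}$ and $R=K[x_1,\ldots,x_d]$. Let $I\subseteq J$ be artinian monomial ideals of $R$ with $\partial\mathrm{oc}(I)\subseteq\partial\mathrm{oc}(J)$. Then $I=J$.
   Context: An ideal $I$ of $R$ is called artinian (or zero-dimensional) if $R/I$ is an artinian ring, equivalently $R/I$ is finite-dimensional over $K$. For a monomial ideal $I$ of $R$ and $\mathfrak{m}=(x_1,\ldots,x_d)$, the docle $\partial\mathrm{oc}(I)$ is the set of monomials in $(I:\mathfrak{m})\setminus I$; i.e. the monomials $a\notin I$ with $x_ia\in I$ for all $i$. *)

(* Defs.v *)
From HB Require Import structures.
From mathcomp Require Import all_boot all_order all_algebra.
From mathcomp Require Import mpoly.
From mathcomp Require Import boolp classical_sets.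

Set Implicit Arguments.
Unset Strict Implicit.
Unset Printing Implicit Defensive.

Import GRing.Theory.

Local Open Scope classical_set_scope.
Local Open Scope ring_scope.
Local Open Scope quotient_scope.

(* Unlike MathComp's [idealr], these ideals are Prop-valued and may be the
   whole ring (which is an artinian monomial ideal, its quotient being 0). *)
Definition is_ideal (R : comPzRingType) (I : set R) : Prop :=
  [/\ I 0, forall x y, I x -> I y -> I (x + y) & forall a x, I x -> I (a * x)].

Record ideal (R : comPzRingType) := Ideal {
  ideal_set :> set R;
  idealP : is_ideal ideal_set
}.

Section IdealQuotient.
Variables (R : comPzRingType) (I : ideal R).

Definition ideal_mem : R -> bool := fun x => `[< ideal_set I x >].

Lemma ideal_mem_zmod : zmod_closed ideal_mem.
Proof.
have [I0 ID IM] := idealP I; split; first exact/asboolP.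
move=> x y /asboolP Ix /asboolP Iy; apply/asboolP.
by apply: ID => //; rewrite -mulN1r; apply: IM.
Qed.

HB.instance Definition _ := GRing.isZmodClosed.Build R ideal_mem ideal_mem_zmod.

Lemma ideal_memM (a x : R) : x \in ideal_mem -> a * x \in ideal_mem.
Proof.
by have [_ _ IM] := idealP I; move=> /asboolP Ix; apply/asboolP/IM.
Qed.

Definition ideal_zmodClosed : zmodClosed R :=
  GRing.ZmodClosed.clone R ideal_mem _.

(* The ring R/I. The library's [Quotient] gives its additive group; its ring
   structure is only provided there for proper ideals, so it is rebuilt below. *)
Definition quo : Type := Quotient.quot ideal_zmodClosed.

HB.instance Definition _ :=
  ZmodQuotient.copy quo (Quotient.quot ideal_zmodClosed).

Definition quo_one : quo := \pi_quo 1.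
Definition quo_mul := lift_op2 quo *%R.

Lemma quo_eqP (x y : R) : reflect (\pi_quo x = \pi_quo y) (x - y \in ideal_mem).
Proof. by rewrite Quotient.idealrBE; apply: eqP. Qed.

Lemma quo_piM (x y : R) : \pi_quo (x * y) = quo_mul (\pi_quo x) (\pi_quo y).
Proof.
rewrite /quo_mul; unlock; apply/quo_eqP; set x' := repr _; set y' := repr _.
have hx : x - x' \in ideal_mem by apply/quo_eqP; rewrite reprK.
have hy : y - y' \in ideal_mem by apply/quo_eqP; rewrite reprK.
have -> : x * y - x' * y' = y * (x - x') + x' * (y - y').
  by rewrite !mulrBr (mulrC y x) (mulrC y x') addrA subrK.
by rewrite rpredD // ideal_memM.
Qed.

Lemma quo_piD (x y : R) : \pi_quo (x + y) = \pi_quo x + \pi_quo y.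
Proof. exact: (raddfD (\pi_(Quotient.quot ideal_zmodClosed))). Qed.

Lemma quo_mulA : associative quo_mul.
Proof.
by elim/quotW=> x; elim/quotW=> y; elim/quotW=> z; rewrite -!quo_piM mulrA.
Qed.

Lemma quo_mulC : commutative quo_mul.
Proof. by elim/quotW=> x; elim/quotW=> y; rewrite -!quo_piM mulrC. Qed.

Lemma quo_mul1 : left_id quo_one quo_mul.
Proof. by elim/quotW=> x; rewrite -quo_piM mul1r. Qed.

Lemma quo_mulDl : left_distributive quo_mul +%R.
Proof.
elim/quotW=> x; elim/quotW=> y; elim/quotW=> z.
by rewrite -quo_piD -!quo_piM -quo_piD mulrDl.
Qed.

HB.instance Definition _ :=
  GRing.Zmodule_isComPzRing.Build quo quo_mulA quo_mulC quo_mul1 quo_mulDl.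

End IdealQuotient.

Definition artinian_ring (A : comPzRingType) : Prop :=
  forall L : nat -> ideal A, (forall n, L n.+1 `<=` L n) ->
  exists N, forall n, (N <= n)%N -> L n = L N :> set A.

Definition artinian_ideal (R : comPzRingType) (I : ideal R) : Prop :=
  artinian_ring (quo I).

Definition ideal_span (R : comPzRingType) (S : set R) : set R :=
  smallest (@is_ideal R) S.

Definition colon (R : comPzRingType) (I M : set R) : set R :=
  [set a | forall b, M b -> I (a * b)].

Definition monomials (K : fieldType) (d : nat) : set {mpoly K[d]} :=
  range (fun m : 'X_{1..d} => 'X_[m]).

Definition monomial_ideal (K : fieldType) (d : nat) (I : ideal {mpoly K[d]}) :
    Prop :=
  exists2 S : set {mpoly K[d]},
    S `<=` @monomials K d & ideal_set I = ideal_span S.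

Definition max_ideal (K : fieldType) (d : nat) : set {mpoly K[d]} :=
  ideal_span (range (fun i : 'I_d => 'X_i)).

Definition docle (K : fieldType) (d : nat) (I : ideal {mpoly K[d]}) :
    set {mpoly K[d]} :=
  @monomials K d `&` (colon I (@max_ideal K d) `\` I).

(* Main.v *)
Require Import Defs.
From HB Require Import structures.
From mathcomp Require Import all_boot all_order all_algebra.
From mathcomp Require Import mpoly.
From mathcomp Require Import boolp classical_sets.

Set Implicit Arguments.
Unset Strict Implicit.
Unset Printing Implicit Defensive.

(** If [I] is strictly smaller than [J], some monomial [a] lies in [J] but not
    in [I]. Multiplying [a] by variables for as long as the product stays
    outside [I] must stop: otherwise the classes in [R/I] of the successive
    products generate a descending chain of ideals, and its stabilization puts
    some [x^m (1 - f)], with [f] having no constant term, in [I]; then [x^m]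
    is in [I], since [I] contains every monomial of each of its elements. The
    last multiple of [a] outside [I] is in the docle of [I], hence in that of
    [J], although it is a multiple of [a] and so an element of [J]. *)

Import GRing.Theory.

Local Open Scope classical_set_scope.
Local Open Scope ring_scope.
Local Open Scope quotient_scope.

Lemma is_ideal_principal (A : comPzRingType) (u : A) :
  is_ideal (range (fun c : A => c * u)).
Proof.
split; first by exists 0; rewrite ?mul0r.
  by move=> _ _ [c _ <-] [c' _ <-]; exists (c + c'); rewrite ?mulrDl.
by move=> b _ [c _ <-]; exists (b * c); rewrite ?mulrA.
Qed.

Lemma is_ideal_colon (R : comPzRingType) (I : ideal R) (a : R) :
  is_ideal [set b | ideal_set I (a * b)].
Proof.
have [I0 ID IM] := idealP I; split; first by rewrite /= mulr0.
  by move=> x y /= Ix Iy; rewrite mulrDr; apply: ID.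
by move=> b x /= Ix; rewrite mulrCA; apply: IM.
Qed.

(** The principal ideals of the [u n] descend; once they are stable, [u n] lies in the ideal of
    [u n.+1]. *)
Lemma artinian_ring_dvd_chain (A : comPzRingType) (u : nat -> A) :
  artinian_ring A -> (forall n, exists c, u n.+1 = c * u n) ->
  exists n c, u n = c * u n.+1.
Proof.
move=> artA u_dvd; pose L n := Ideal (is_ideal_principal (u n)).
have [n _ [c _ <-]|N LN] := artA L.
  by have [b ->] := u_dvd n; exists (c * b); rewrite ?mulrA.
have : ideal_set (L N) (u N) by exists 1; rewrite ?mul1r.
by rewrite -(LN N.+1) // => -[c _ cE]; exists N, c.
Qed.

Lemma monomial_ideal_msupp (K : fieldType) (d : nat) (I : ideal {mpoly K[d]})
    (p : {mpoly K[d]}) (m : 'X_{1..d}) :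
  monomial_ideal I -> ideal_set I p -> m \in msupp p -> ideal_set I 'X_[m].
Proof.
move=> [S S_mon IE] Ip; have [_ _ IM] := idealP I.
(* [T] is an ideal containing the generators [S], hence their span. *)
pose T := [set q : {mpoly K[d]} |
  forall k, k \in msupp q -> ideal_set I 'X_[k]].
suff: T p by apply.
have: ideal_span S p by rewrite -IE.
apply; split; first split.
- by move=> k; rewrite msupp0.
- move=> q r Tq Tr k /msuppD_le; rewrite mem_cat => /orP[]; [exact: Tq|exact: Tr].
- move=> a q Tq k /msuppM_le /allpairsP[[k1 k2] /= [_ k2q ->]].
  by rewrite mpolyXD; apply/IM/Tq.
move=> q Sq k; have [k' _ qE] := S_mon q Sq.
rewrite -qE msuppX inE => /eqP ->; rewrite qE IE.
by move=> B [_]; apply.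
Qed.

(** The [b] with ['X_[m] * b] in [I] form an ideal, so it is enough to test the variables. *)
Lemma docle_monomial (K : fieldType) (d : nat) (I : ideal {mpoly K[d]})
    (m : 'X_{1..d}) :
  ~ ideal_set I 'X_[m] -> (forall i, ideal_set I 'X_[m + U_(i)]) ->
  docle I 'X_[m].
Proof.
move=> Im Imi; split; [by exists m | split=> // b].
move/(_ _ (conj (is_ideal_colon I 'X_[m]) _)); apply.
by move=> _ [i _ <-]; rewrite /= -mpolyXD.
Qed.

(* Every monomial of the second term is a proper multiple of ['X_[m]], so the
   difference has coefficient 1 at [m]. *)
Lemma monomial_ideal_cancel (K : fieldType) (d : nat) (I : ideal {mpoly K[d]})
    (m : 'X_{1..d}) (i : 'I_d) (p : {mpoly K[d]}) :
  monomial_ideal I -> ideal_set I ('X_[m] - p * 'X_[m + U_(i)]) ->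
  ideal_set I 'X_[m].
Proof.
move=> Imon Ip; apply: (monomial_ideal_msupp Imon Ip).
rewrite mcoeff_msupp mcoeffB mcoeffX eqxx.
suff -> : (p * 'X_[m + U_(i)])@_m = 0 by rewrite subr0 oner_eq0.
apply/eqP; rewrite -[_ == 0]negbK -mcoeff_msupp (perm_mem (msuppMX _ _)).
apply/negP => /mapP[k _ /mnmP/(_ i)]; rewrite !mnmDE mnm1E eqxx.
by rewrite addnAC -addnA addn1 => /eqP; rewrite -{1}[m i]addn0 eqn_add2l.
Qed.

Lemma docle_above (K : fieldType) (d : nat) (I : ideal {mpoly K[d]})
    (m : 'X_{1..d}) :
  monomial_ideal I -> artinian_ideal I -> ~ ideal_set I 'X_[m] ->
  exists k, docle I 'X_[m + k].
Proof.
move=> Imon Iart Im; apply: contrapT => no_docle.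
(* The implication makes [f] total: where ['X_[m + k]] is already in [I], any [k'] will do. *)
have /choice[f fP] (k : 'X_{1..d}) : exists k', ~ ideal_set I 'X_[m + k] ->
    ~ ideal_set I 'X_[m + k'] /\ exists i, k' = (k + U_(i))%MM.
  have [Ik|Ik] := pselect (ideal_set I 'X_[m + k]); first by exists k.
  apply: contrapT => stuck; apply: no_docle; exists k.
  apply: docle_monomial => // i; apply: contrapT => Ii; apply: stuck.
  by exists (k + U_(i))%MM => _; split; [rewrite addmA | exists i].
pose e n := iter n f 0%MM.
have Ie n : ~ ideal_set I 'X_[m + e n].
  by elim: n => [|n IHn]; [rewrite addm0 | have [] := fP _ IHn].
have eS n : exists i, (m + e n.+1)%MM = (m + e n + U_(i))%MM.
  by have [_ [i fE]] := fP _ (Ie n); exists i; rewrite -addmA -fE.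
pose u n : quo I := \pi_(quo I) 'X_[m + e n].
have [n|n [c]] := artinian_ring_dvd_chain (u := u) Iart.
  have [i eE] := eS n; exists (\pi_(quo I) 'X_[U_(i)]).
  by rewrite /u eE addmC mpolyXD quo_piM.
(* Lifting [c] to a polynomial [p] turns the equality in the quotient into a membership in [I]. *)
elim/quotW: c => p; have [i eE] := eS n.
rewrite /u eE -[RHS]quo_piM => /quo_eqP/asboolP.
by move=> /(monomial_ideal_cancel Imon)/Ie.
Qed.

Theorem corollary5p4 (K : fieldType) (d : nat) (I J : ideal {mpoly K[d]}) :
  monomial_ideal I -> artinian_ideal I ->
  monomial_ideal J -> artinian_ideal J ->
  I `<=` J -> docle I `<=` docle J ->
  I = J :> set {mpoly K[d]}.
Proof.
move=> Imon Iart [S S_mon JE] _ IJ docIJ; have [_ _ JM] := idealP J.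
(* [J] is the least ideal containing [S], so it suffices that [I] contains each monomial of [S]. *)
apply/seteqP; split=> //; rewrite JE => p; apply.
split=> [|q Sq]; first exact: idealP.
have [m _ mE] := S_mon q Sq; rewrite -mE; apply: contrapT => Im.
have [k /docIJ[_ [_ +]]] := docle_above Imon Iart Im; apply.
rewrite addmC mpolyXD; apply: JM; rewrite JE mE.
by move=> B [_]; apply.
Qed.
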